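(* Let $p,m,n\in\mathbb{N}_0$ and $\alpha>-1$ with $|n-m|\le p\le m+n$. Write $G_{p,m,n}=G_{p,m,n}^\alpha$, where for $p\ge|n-m|$ $$G_{p,m,n}^\alpha=\frac{\Gamma(\alpha+1+m\vee n)\,2^{2(m\wedge n)}(\frac12)_{m\wedge n}}{|n-m|!\,(p-|n-m|)!}\;{}_3F_2\!\left({-\alpha-m\wedge n,\ \frac{|n-m|-p}2,\ \frac{|n-m|-p+1}2\atop 1+|n-m|,\ \frac12-m\wedge n};1\right).$$ Then the following three contiguous relations (coming from the integral of a product of three Laguerre polynomials) hold: $$(m+\alpha)(m+n-p)\,G_{p,m-1,n}-(p+1)(m+n-p)\,G_{p+1,m,n}+\frac{m+1}{m+n-p+1}\,G_{p,m+1,n}-\frac{p+\alpha}{m+n-p+1}\,G_{p-1,m,n}-2(p-m)\,G_{p,m,n}=0,$$ $$(n+\alpha)(m+n-p)\,G_{p,m,n-1}-(p+1)(m+n-p)\,G_{p+1,m,n}+\frac{n+1}{m+n-p+1}\,G_{p,m,n+1}-\frac{p+\alpha}{m+n-p+1}\,G_{p-1,m,n}-2(p-n)\,G_{p,m,n}=0,$$ $$(n+\alpha)(m+n-p)\,G_{p,m,n-1}-(m+\alpha)(m+n-p)\,G_{p,m-1,n}-\frac{m+1}{m+n-p+1}\,G_{p,m+1,n}+\frac{n+1}{m+n-p+1}\,G_{p,m,n+1}-2(m-n)\,G_{p,m,n}=0.$$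
   Context: $\mathbb{N}_0=\{0,1,2,\ldots\}$; $m\vee n=\max(m,n)$, $m\wedge n=\min(m,n)$; $(z)_j=z(z+1)\cdots(z+j-1)$; ${}_3F_2\!\left({a_1,a_2,a_3\atop b_1,b_2};x\right)=\sum_{j\ge0}\frac{(a_1)_j(a_2)_j(a_3)_j}{(b_1)_j(b_2)_j}\frac{x^j}{j!}$. Convention: $G_{p,m,n}^\alpha:=0$ if $p<|n-m|$ (reciprocal factorial of a negative integer is $0$) or if one of $p,m,n$ equals $-1$. For $|n-m|\le p\le m+n$ one has $\int_0^\infty L_p^\alpha(x)L_m^\alpha(x)L_n^\alpha(x)x^\alpha e^{-x}\,dx=(-1)^{p+m+n}G^\alpha_{p,m,n}/(m+n-p)!$, with $L_n^\alpha$ the Laguerre polynomials. *)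

(* Defs.v *)
From mathcomp Require Import all_boot all_order all_algebra.
From mathcomp Require Import all_classical all_reals all_analysis.

Set Implicit Arguments.
Unset Strict Implicit.
Unset Printing Implicit Defensive.

Import Order.TTheory GRing.Theory Num.Theory.
Import numFieldNormedType.Exports.

Local Open Scope classical_set_scope.
Local Open Scope ring_scope.

(* Euler's integral; it converges, and so agrees with the Gamma function,
   for z > 0. *)
Definition Gamma (R : realType) (z : R) : R :=
  \int[@lebesgue_measure R]_(x in `]0, +oo[) (x `^ (z - 1) * expR (- x)).

Definition pochhammer (R : realType) (z : R) (j : nat) : R :=
  \prod_(0 <= i < j) (z + i%:R).

Definition hyp3F2 (R : realType) (a1 a2 a3 b1 b2 x : R) : R :=
  limn (series (fun j : nat =>
    pochhammer a1 j * pochhammer a2 j * pochhammer a3 j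
      / (pochhammer b1 j * pochhammer b2 j) * (x ^+ j / j`!%:R))).

Definition G_nat (R : realType) (alpha : R) (p m n : nat) : R :=
  let d := `|n%:Z - m%:Z|%N in
  let k := minn m n in
  if (p < d)%N then 0 else
  Gamma (alpha + 1 + (maxn m n)%:R) * 2 ^+ (2 * k) * pochhammer (1 / 2) k
    / (d`!%:R * (p - d)`!%:R)
  * hyp3F2 (- alpha - k%:R) ((d%:R - p%:R) / 2) ((d%:R - p%:R + 1) / 2)
           (1 + d%:R) (1 / 2 - k%:R) 1.

(* Integer indices are needed because the contiguous relations shift an index
   down from 0 to -1, where G is zero by convention. *)
Definition G (R : realType) (alpha : R) (p m n : int) : R :=
  match p, m, n with
  | Posz p', Posz m', Posz n' => G_nat alpha p' m' n'
  | _, _, _ => 0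
  end.

(* Main.v *)
Require Import Defs.
From mathcomp Require Import all_boot all_order all_algebra.
From mathcomp Require Import all_classical all_reals all_analysis.
From mathcomp Require Import measurable_realfun zify ring lra.

(* With a = alpha + 1 and q = m + n - p, reversing the order of summation in
   the terminating 3F2 gives the form, symmetric in m and n,
     G_{p,m,n} = Gamma(a) (a)_m (a)_n
       sum_i c_i / ((m - i)! (n - i)! (2 i - q)!),  c_i = 4^i (1/2)_i / (a)_i.
   The shifts of p, m, n only shift the arguments of the reciprocal factorials,
   so the first relation becomes the vanishing of a sum of hypergeometric
   terms, which telescopes. The second relation is the first with m and n
   exchanged, and the third is their difference. *)

Set Implicit Arguments.
Unset Strict Implicit.
Unset Printing Implicit Defensive.

Import Order.TTheory GRing.Theory Num.Theory.
Import numFieldNormedType.Exports.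

Local Open Scope classical_set_scope.
Local Open Scope ring_scope.

(** * Functional equation of the Gamma integral *)

Lemma powR_expRN_le (R : realType) (z : R) (M : nat) (x : R) :
  z <= M%:R -> 1 <= x -> x `^ z * expR (- x) <= M.+1`!%:R / x.
Proof.
move=> zM x1; have x0 : 0 < x by apply: lt_le_trans x1.
apply: (@le_trans _ _ (x ^+ M * expR (- x))).
  by rewrite ler_wpM2r ?expR_ge0// -powR_mulrn ?(ltW x0)//; exact: ler_powR.
have := expR_ge1Dxn M (ltW x0); rewrite expRN => h.
rewrite ler_pdivrMr ?expR_gt0// mulrAC ler_pdivlMr// -exprSr.
rewrite -ler_pdivrMl ?ltr0n ?fact_gt0// mulrC.
by apply: le_trans h; rewrite lerDr.
Qed.

(** Exhaustion by compact intervals, on which integration by parts is available. The shift to [k.+2]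
    keeps every interval nondegenerate, already at [k = 0]. *)
Lemma itv_oy_bigcup (R : realType) :
  `]0, +oo[%classic = \bigcup_k `[(k.+2%:R : R)^-1, k.+2%:R]%classic.
Proof.
apply/seteqP; split=> x /=; rewrite in_itv/= ?andbT.
  move=> x0; exists (maxn (Num.bound x) (Num.bound x^-1)) => //=.
  set k := maxn _ _; rewrite in_itv/=; apply/andP; split.
    rewrite invf_ple ?posrE//.
    apply: le_trans (ltW (archi_boundP _)) _; first by rewrite invr_ge0 ltW.
    by rewrite ler_nat leqW// leqW// leq_maxr.
  apply: le_trans (ltW (archi_boundP (ltW x0))) _.
  by rewrite ler_nat leqW// leqW// leq_maxl.
move=> [k _] /=; rewrite in_itv/= => /andP[+ _].
by apply: lt_le_trans; rewrite invr_gt0.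
Qed.

Lemma cvg_powR_expRN_boundary (R : realType) (z : R) : 0 < z ->
  (fun k => (k.+2%:R^-1 : R) `^ z * expR (- k.+2%:R^-1)
    - (k.+2%:R) `^ z * expR (- k.+2%:R)) @ \oo --> 0.
Proof.
move=> z0.
have inv0 : (fun k => k.+2%:R^-1 : R) @ \oo --> 0.
  by have := @cvg_harmonic R; rewrite -cvg_shiftS.
rewrite -[X in _ --> X](subr0 0); apply: cvgB.
  (* At the left end the exponential is at most 1, and the power tends to 0 because [0 < z]. *)
  apply: (@squeeze_cvgr _ _ _ _ (fun=> 0) (fun k => (k.+2%:R^-1) `^ z)).
  - near=> k; rewrite mulr_ge0 ?powR_ge0 ?expR_ge0//=.
    by rewrite ler_piMr ?powR_ge0// -expR0 ler_expR oppr_le0 invr_ge0.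
  - exact: cvg_cst.
  - have /cvg_at_rightP/(_ (fun k => k.+2%:R^-1)) := powR_cvg0 z0.
    by apply; split=> //= n; rewrite invr_gt0.
pose M := Num.bound z.
apply: (@squeeze_cvgr _ _ _ _ (fun=> 0) (fun k => M.+1`!%:R * k.+2%:R^-1)).
- near=> k; rewrite mulr_ge0 ?powR_ge0 ?expR_ge0//=.
  apply: powR_expRN_le; last by rewrite ler1n.
  exact: ltW (archi_boundP (ltW z0)).
- exact: cvg_cst.
- by rewrite -[X in _ --> X](mulr0 (M.+1`!%:R : R)); apply: cvgMr.
Unshelve. all: end_near. Qed.

(* Integration by parts on [1/k, k] and monotone limits in the extended reals,
   so that finiteness of the integral is not required. *)
Lemma GammaS (R : realType) (z : R) : 0 < z -> Gamma (z + 1) = z * Gamma z.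
Proof.
move=> z0; rewrite /Gamma addrK /Rintegral.
set mu := lebesgue_measure.
pose I k : set R := `[k.+2%:R^-1, k.+2%:R]%classic.
pose D0 : set R := `]0, +oo[%classic.
pose h (w x : R) := (x `^ w * expR (- x))%:E.
have mh w (D : set R) : measurable_fun D (h w).
  apply/measurable_EFinP; apply: measurable_funTS; apply: measurable_funM.
    exact: measurable_powR.
  by apply: measurableT_comp => //; exact: measurable_expR.
have h0 w x : (0 <= h w x)%E by rewrite lee_fin mulr_ge0 ?powR_ge0 ?expR_ge0.
have cvI w : (\int[mu]_(x in I k) h w x)%E @[k --> \oo] -->
             (\int[mu]_(x in D0) h w x)%E.
  rewrite /D0 itv_oy_bigcup; apply: ge0_nondecreasing_set_cvg_integral => //.
  - apply/nondecreasing_seqP => k; rewrite subsetEset => x /=.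
    rewrite /I/= !in_itv/= => /andP[kx xk]; apply/andP; split.
      by apply: le_trans kx; rewrite lef_pV2 ?posrE// ler_nat.
    by apply: le_trans xk _; rewrite ler_nat.
  - by move=> i; exact: measurable_itv.
  - by move=> i; exact: mh.
pose bd k : R := k.+2%:R^-1 `^ z * expR (- k.+2%:R^-1)
  - k.+2%:R `^ z * expR (- k.+2%:R).
have parts k : (\int[mu]_(x in I k) h z x)%E =
   ((bd k)%:E + z%:E * \int[mu]_(x in I k) h (z - 1)%R x)%E.
  have k0 : 0 < k.+2%:R^-1 :> R by rewrite invr_gt0.
  have kk : k.+2%:R^-1 < k.+2%:R :> R.
    apply: (@lt_trans _ _ 1); last by rewrite ltr1n.
    by rewrite invf_lt1 ?ltr1n.
  have dP (v x : R) : 0 < x -> {for x, continuous (fun y : R => y `^ v)}.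
    move=> x0; apply/differentiable_continuous/derivable1_diffP.
    by apply: derivable_powR; rewrite in_itv/= x0.
  have cE : continuous (fun x : R => expR (- x)).
    move=> x; apply: continuous_comp; first exact: oppr_continuous.
    exact: continuous_expR.
  have sub x : x \in `[k.+2%:R^-1, (k.+2%:R : R)] -> 0 < x.
    by rewrite in_itv/= => /andP[+ _]; exact: lt_le_trans.
  rewrite (integration_by_parts (F := fun x : R => x `^ z)
    (f := fun x : R => z * x `^ (z - 1)) (g := fun x : R => expR (- x))
    (G := fun x : R => - expR (- x)) kk).
  - rewrite !mulrN opprK [- _ + _]addrC; congr (_ + _)%E.
    rewrite -ge0_integralZl//; last 3 first.
    - exact: measurable_itv.
    - exact: mh.
    - by rewrite lee_fin ltW.
    (* The integrand is nonpositive, so its positive part integrates to 0 and the sign can be moved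
       out even if the integral is infinite. *)
    rewrite -integralN/=; last first.
      apply: fin_num_adde_defr; rewrite integral0_eq// => x _.
      rewrite funeposE; apply/max_idPr; rewrite lee_fin mulrN oppr_le0.
      by rewrite !mulr_ge0 ?powR_ge0 ?expR_ge0// ltW.
    by apply: eq_integral => x _; rewrite /h -EFinM mulrN opprK mulrA.
  - apply: continuous_in_subspaceT => x; rewrite inE/= => /sub x0.
    by apply: cvgM; [exact: cvg_cst|exact: dP].
  - split.
    + move=> x /subset_itv_oo_cc/sub x0.
      by apply: derivable_powR; rewrite in_itv/= x0.
    + by apply: cvg_at_right_filter; exact: dP.
    + by apply: cvg_at_left_filter; apply: dP; rewrite ltr0n.
  - move=> x /subset_itv_oo_cc/sub x0.
    by apply: powR_derive1; rewrite in_itv/= x0.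
  - exact: continuous_subspaceT.
  - split.
    + by move=> x _; apply: ex_derive.
    + by apply: cvg_at_right_filter; apply: cvgN; exact: cE.
    + by apply: cvg_at_left_filter; apply: cvgN; exact: cE.
  - move=> x _; rewrite derive1E derive_val/=.
    by rewrite mulrN1 opprK.
have bd0 : (EFin \o bd) @ \oo --> 0%:E.
  by apply: cvg_EFin; [exact: nearW|exact: cvg_powR_expRN_boundary].
have cz : (\int[mu]_(x in I k) h z x)%E @[k --> \oo] -->
    (z%:E * \int[mu]_(x in D0) h (z - 1)%R x)%E.
  rewrite (_ : (fun k => _) = (fun k =>
    (EFin \o bd) k + z%:E * \int[mu]_(x in I k) h (z - 1)%R x)%E).
    rewrite -[X in _ --> X]add0e; apply: cvgeD => //.
    by apply: cvgeZl => //; exact: cvI.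
  by apply/funext => k; rewrite parts.
have Ilim := cvg_unique (@ereal_hausdorff R) (cvI z) cz.
rewrite -/D0 -/(h z) -/(h (z - 1)%R) Ilim.
(* The real-valued integral sends infinite values to 0, so both sides would be 0 in the infinite
   cases. *)
case: (\int[mu]_(x in D0) h (z - 1)%R x)%E => [r||] //=.
  by rewrite gt0_muley ?lte_fin// mulr0.
by rewrite gt0_muleNy ?lte_fin// mulr0.
Qed.

(** * Pochhammer symbols and reciprocal factorials *)

Lemma pochhammer0 (R : realType) (z : R) : pochhammer z 0 = 1.
Proof. by rewrite /pochhammer big_geq. Qed.

Lemma pochhammerS (R : realType) (z : R) j :
  pochhammer z j.+1 = pochhammer z j * (z + j%:R).
Proof. by rewrite /pochhammer big_nat_recr. Qed.

Lemma pochhammer_gt0 (R : realType) (z : R) j : 0 < z -> 0 < pochhammer z j.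
Proof.
move=> z0; elim: j => [|j IHj]; first by rewrite pochhammer0.
by rewrite pochhammerS mulr_gt0// ltr_wpDr.
Qed.

Lemma Gamma_pochhammer (R : realType) (z : R) n :
  0 < z -> Gamma (z + n%:R) = pochhammer z n * Gamma z.
Proof.
move=> z0; elim: n => [|n IHn]; first by rewrite pochhammer0 addr0 mul1r.
rewrite -natr1 addrA GammaS ?ltr_wpDr// IHn pochhammerS; ring.
Qed.

(** Up to sign, the factors of [pochhammer (1 - a - k%:R) j] are the last [j] factors of
    [pochhammer a k], in reverse order. *)
Lemma pochhammer_reflect (R : realType) (a : R) k j : (j <= k)%N ->
  pochhammer (1 - a - k%:R) j * pochhammer a (k - j)
  = (-1) ^+ j * pochhammer a k.
Proof.
elim: j => [|j IHj] jk; first by rewrite subn0 pochhammer0 expr0.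
rewrite exprS -mulrA -IHj; last exact: ltnW.
rewrite pochhammerS -(subnSK jk) pochhammerS natrB//.
by rewrite -(natr1 j); ring.
Qed.

(** This is 1/Gamma(z+1) on the integers. Its zeros at negative arguments cut sums off at their
    natural bounds and let the shift rule [rfactB1] hold for every integer. *)
Definition rfact (R : realType) (z : int) : R :=
  if z is Posz n then n`!%:R^-1 else 0.

Lemma rfact_lt0 (R : realType) (z : int) : z < 0 -> rfact R z = 0.
Proof. by case: z. Qed.

Lemma rfactB1 (R : realType) (z : int) : rfact R (z - 1) = z%:~R * rfact R z.
Proof.
case: z => [[|n]|n].
- by rewrite mul0r.
- have -> : n.+1%:Z - 1 = n by lia.
  by rewrite /= factS natrM invfM mulrA -pmulrn divff ?mul1r// pnatr_eq0.
- by rewrite !rfact_lt0 ?mulr0//; lia.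
Qed.

Lemma pochhammer_rfact (R : realType) d j :
  (d`!%:R * pochhammer (1 + d%:R) j)^-1 = rfact R (d + j)%N.
Proof.
rewrite /=; congr (_^-1).
elim: j => [|j IHj]; first by rewrite pochhammer0 mulr1 addn0.
by rewrite pochhammerS mulrA IHj addnS factS natrM -addn1 !natrD; ring.
Qed.

(** Duplication: interleaving the factors of both symbols gives (-r)_{2j} / 4^j, and (-r)_{2j} =
    r!/(r-2j)!, which is 0 once 2j > r. *)
Lemma pochhammer_half (R : realType) (r j : nat) :
  pochhammer (- r%:R / 2) j * pochhammer ((- r%:R + 1) / 2) j
  = r`!%:R * rfact R (r%:Z - (2 * j)%:Z) / 4 ^+ j.
Proof.
elim: j => [|j IHj].
  rewrite !pochhammer0 subr0 /= divff ?pnatr_eq0 -?lt0n ?fact_gt0//.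
  by rewrite expr0 divr1 mulr1.
rewrite !pochhammerS mulrACA IHj.
have -> : r%:Z - (2 * j.+1)%:Z = r%:Z - (2 * j)%:Z - 1 - 1 by lia.
rewrite !rfactB1 exprS.
have h4 : (4 : R) ^+ j != 0 by rewrite expf_neq0.
have -> : (r%:Z - (2 * j)%:Z)%:~R = r%:R - 2 * j%:R :> R.
  by rewrite rmorphB/= -!pmulrn natrM.
rewrite rmorphB; move: (rfact _ _) => y /=.
by field.
Qed.

(** * The symmetric sum and its contiguous relation *)

Definition coef (R : realType) (a : R) i :=
  4 ^+ i * pochhammer (1 / 2) i / pochhammer a i.

Lemma coefS (R : realType) (a : R) i : 0 < a ->
  (a + i%:R) * coef a i.+1 = 2 * (2 * i%:R + 1) * coef a i.
Proof.
move=> a0; rewrite /coef exprS !pochhammerS.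
have h1 : pochhammer a i != 0 by rewrite gt_eqF// pochhammer_gt0.
have h2 : a + i%:R != 0 by rewrite gt_eqF// ltr_wpDr.
by field; rewrite h1 h2.
Qed.

(** The bound [N] is independent of the other indices: terms with i > m vanish anyway, so one large
    [N] serves all shifted sums, which can then be combined term by term. *)
Definition tsum (R : realType) (a : R) N (q m n : int) : R :=
  \sum_(0 <= i < N) coef a i * (rfact R (m - i%:Z) * rfact R (n - i%:Z)
    * rfact R (2 * i%:Z - q)).

Lemma tsumC (R : realType) (a : R) N q m n : tsum a N q m n = tsum a N q n m.
Proof. by apply: eq_bigr => i _; rewrite [rfact _ (m - _) * _]mulrC. Qed.

(** A nonzero term needs q/2 <= i <= m. With q = m + n - p, the condition q > 2m reads p < n - m, so
    the sum reproduces the vanishing conventions for G. *)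
Lemma tsum_eq0 (R : realType) (a : R) N (q m n : int) :
  (m < 0) || (2 * m < q) -> tsum a N q m n = 0.
Proof.
move=> h; apply: big1 => i _.
have [mi|im] := ltP m i%:Z.
  by rewrite (@rfact_lt0 _ (m - i%:Z)) ?mul0r ?mulr0//; lia.
by rewrite (@rfact_lt0 _ (2 * i%:Z - q)) ?mulr0//; lia.
Qed.

(** The first relation multiplied by q + 1 and divided by Gamma(a) (a)_m (a)_n. *)
Lemma tsum_contiguous (R : realType) (a p : R) N (q m n : int) : 0 < a ->
  p = m%:~R + n%:~R - q%:~R -> m + 1 < N%:Z ->
  q%:~R * (q%:~R + 1) * tsum a N (q - 1) (m - 1) n
  - (p + 1) * q%:~R * (q%:~R + 1) * tsum a N (q - 1) m n
  + (m%:~R + 1) * (m%:~R + a) * tsum a N (q + 1) (m + 1) n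
  - (p + a - 1) * tsum a N (q + 1) m n
  - 2 * (p - m%:~R) * (q%:~R + 1) * tsum a N q m n = 0.
Proof.
move=> a0 pE mN.
(* Zeilberger certificate, with T 0 = T N = 0. *)
pose T i := - (i%:R * (a - 1 + i%:R) * coef a i * (rfact R (m + 1 - i%:Z)
  * rfact R (n - i%:Z) * rfact R (2 * i%:Z - q - 1))).
transitivity (T N - T 0); last first.
  rewrite /T !mul0r (@rfact_lt0 _ (m + 1 - N%:Z)); last by lia.
  by rewrite !(mul0r, mulr0, subr0, oppr0).
rewrite -(telescope_sumr T)// /tsum !mulr_sumr -!(sumrN, big_split)/=.
apply: eq_bigr => i _; rewrite /T.
(* [x], [y], [z] are the largest arguments that occur. By [rfactB1] every other reciprocal factorial
   is a polynomial multiple of one of these three, leaving a rational identity. *)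
pose x : int := m + 1 - i%:Z; pose y : int := n - i%:Z.
pose z : int := 2 * i%:Z - q + 1.
have -> : m - i%:Z = x - 1 by rewrite /x; lia.
have -> : m - 1 - i%:Z = x - 1 - 1 by rewrite /x; lia.
have -> : m + 1 - i.+1%:Z = x - 1 by rewrite /x; lia.
have -> : n - i.+1%:Z = y - 1 by rewrite /y; lia.
have -> : 2 * i%:Z - (q - 1) = z by rewrite /z; lia.
have -> : 2 * i%:Z - (q + 1) = z - 1 - 1 by rewrite /z; lia.
have -> : 2 * i%:Z - q - 1 = z - 1 - 1 by rewrite /z; lia.
have -> : 2 * i%:Z - q = z - 1 by rewrite /z; lia.
have -> : 2 * i.+1%:Z - q - 1 = z by rewrite /z; lia.
rewrite -/x -/y !rfactB1.
have xE : x%:~R = m%:~R + 1 - i%:R :> R by rewrite rmorphB rmorphD/= -pmulrn.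
have yE : y%:~R = n%:~R - i%:R :> R by rewrite rmorphB/= -pmulrn.
have zE : z%:~R = 2 * i%:R - q%:~R + 1 :> R.
  by rewrite rmorphD rmorphB rmorphM/= -pmulrn.
clearbody x y z; rewrite !rmorphB/= xE yE zE -natr1.
have ai : a + i%:R != 0 by rewrite gt_eqF// ltr_wpDr.
have -> : coef a i.+1 = 2 * (2 * i%:R + 1) * coef a i / (a + i%:R).
  by rewrite -coefS// mulrAC divff ?mul1r.
by rewrite pE; field.
Qed.

(** * From the terminating 3F2 to the symmetric sum *)

Lemma hyp3F2_finite (R : realType) (a b1 b2 : R) r K : (r < 2 * K)%N ->
  hyp3F2 a (- r%:R / 2) ((- r%:R + 1) / 2) b1 b2 1
  = \sum_(0 <= j < K) pochhammer a j
      * (r`!%:R * rfact R (r%:Z - (2 * j)%:Z) / 4 ^+ j)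
      / (pochhammer b1 j * pochhammer b2 j) / j`!%:R.
Proof.
move=> rK; rewrite /hyp3F2; set u := (X in series X).
have uE j : u j = pochhammer a j
      * (r`!%:R * rfact R (r%:Z - (2 * j)%:Z) / 4 ^+ j)
      / (pochhammer b1 j * pochhammer b2 j) / j`!%:R.
  by rewrite /u expr1n -pochhammer_half mul1r !mulrA.
under eq_bigr do rewrite -uE.
(* The terms with j >= K contain [rfact] at a negative integer, so the partial sums are constant
   from [K] on. *)
apply: lim_near_cst; first exact: norm_hausdorff.
near=> n.
have Kn : (K <= n)%N by near: n; exact: nbhs_infty_ge.
rewrite /series/= (big_cat_nat _ Kn)//= [X in _ + X]big_nat_cond.
rewrite [X in _ + X]big1 ?addr0//.
move=> j /andP[/andP[Kj _] _]; rewrite uE rfact_lt0 ?(mulr0, mul0r)//; lia.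
Unshelve. all: end_near. Qed.

Lemma tsum_trunc (R : realType) (a : R) N q (m : nat) n : (m < N)%N ->
  tsum a N q m n = tsum a m.+1 q m n.
Proof.
move=> mN; rewrite /tsum (big_cat_nat _ mN)//= [X in _ + X]big_nat_cond.
rewrite [X in _ + X]big1 ?addr0// => i /andP[/andP[mi _] _].
by rewrite (@rfact_lt0 _ (m%:Z - i%:Z)) ?(mul0r,mulr0)//; lia.
Qed.

Lemma G_natC (R : realType) (alpha : R) p m n :
  G_nat alpha p m n = G_nat alpha p n m.
Proof. by rewrite /G_nat minnC maxnC distnC. Qed.

Lemma GC (R : realType) (alpha : R) p m n : G alpha p m n = G alpha p n m.
Proof. by case: p m n => [p|p] [m|m] [n|n] //; exact: G_natC. Qed.

Lemma G_nat_tsum (R : realType) (alpha : R) p m n N : -1 < alpha ->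
  (p <= m + n)%N -> (m + n < N)%N ->
  G_nat alpha p m n = Gamma (alpha + 1) * pochhammer (alpha + 1) m
    * pochhammer (alpha + 1) n * tsum (alpha + 1) N (m%:Z + n%:Z - p%:Z) m n.
Proof.
move=> halpha.
wlog mn : m n / (m <= n)%N => [hw pmn mnN|pmn mnN].
  have [mn|/ltnW nm] := leqP m n; first exact: hw.
  rewrite G_natC tsumC hw//; [|lia|lia].
  by rewrite [_%:Z + _]addrC; ring.
have a0 : 0 < alpha + 1 by lra.
have [d nE] : exists d, n = (m + d)%N by exists (n - m)%N; lia.
rewrite /G_nat nE.
have -> : `|(m + d)%N%:Z - m%:Z|%N = d by lia.
have -> : minn m (m + d) = m by lia.
have -> : maxn m (m + d) = (m + d)%N by lia.
(* If p < d, then q = 2m + d - p exceeds 2m and both sides are 0. *)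
case: ifP => [pd|/negbT]; first by rewrite tsum_eq0 ?mulr0//; lia.
rewrite -leqNgt => dp.
have [r pE] : exists r, p = (d + r)%N by exists (p - d)%N; lia.
rewrite pE addKn.
have -> : d%:R - (d + r)%N%:R = - r%:R :> R by rewrite natrD; ring.
rewrite (@hyp3F2_finite _ _ _ _ r m.+1); last by lia.
have -> : - alpha - m%:R = 1 - (alpha + 1) - m%:R by ring.
move: (alpha + 1) a0 => a a0.
rewrite Gamma_pochhammer//.
rewrite tsum_trunc; last by lia.
(* The reversal i = m - j matches the two sums term by term. *)
rewrite /tsum [in RHS]big_nat_rev/= add0n !mulr_sumr.
rewrite !big_mkord; apply: eq_bigr => -[j /= jm] _; rewrite subSS.
have -> : 2 * (m - j)%N%:Z - (m%:Z + (m + d)%N%:Z - (d + r)%N%:Z)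
   = r%:Z - (2 * j)%:Z by lia.
have -> : m%:Z - (m - j)%N%:Z = j by lia.
have -> : (m + d)%N%:Z - (m - j)%N%:Z = (d + j)%N by lia.
rewrite -pochhammer_rfact /coef.
have e1 := @pochhammer_reflect _ a m j jm.
have e2 := @pochhammer_reflect _ (1 / 2 : R) m j jm.
have -> : 1 / 2 - m%:R = 1 - 1 / 2 - m%:R :> R by field.
have -> : rfact R j%:Z = j`!%:R^-1 by [].
have half0 : pochhammer (1 / 2 : R) m != 0.
  by rewrite gt_eqF// pochhammer_gt0//; lra.
have D0 : pochhammer (1 + d%:R : R) j != 0.
  by rewrite gt_eqF// pochhammer_gt0// ltr_wpDr.
have Q0 : pochhammer a (m - j) != 0 by rewrite gt_eqF// pochhammer_gt0.
(* By reflection this symbol divides (1/2)_m up to sign, and (1/2)_m is positive. *)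
have E0 : pochhammer (1 - 1 / 2 - m%:R : R) j != 0.
  apply: contra_neq half0 => E0; apply: (mulfI (_ : (-1) ^+ j != 0)).
    by rewrite signr_eq0.
  by rewrite -e2 E0 mul0r mulr0.
have -> : pochhammer (1 - a - m%:R) j =
  (-1) ^+ j * pochhammer a m / pochhammer a (m - j).
  by rewrite -e1 mulfK.
have -> : pochhammer (1 / 2 : R) m = (-1) ^+ j
    * (pochhammer (1 - 1 / 2 - m%:R) j * pochhammer (1 / 2) (m - j)).
  by rewrite e2 mulrA -expr2 sqrr_sign !mul1r.
have -> : 2 ^+ (2 * m) = 4 ^+ (m - j) * 4 ^+ j :> R.
  by rewrite -exprD subnK// exprM; congr (_ ^+ _); ring.
have f40 : (4 : R) ^+ j != 0 by rewrite expf_neq0.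
have fact0 i : i`!%:R != 0 :> R by rewrite pnatr_eq0 -lt0n fact_gt0.
rewrite -signr_odd; case: (odd j); rewrite ?expr0 ?expr1; field.
all: by rewrite D0 Q0 E0 f40 !fact0.
Qed.

(** * Transfer of the relation to G, and the three relations *)

Lemma G_contiguous (R : realType) (alpha : R) (p m n : nat) :
  -1 < alpha -> (p <= m + n)%N ->
  (m%:R + alpha) * (m%:R + n%:R - p%:R) * G alpha p%:Z (m%:Z - 1) n%:Z
      - (p%:R + 1) * (m%:R + n%:R - p%:R) * G alpha (p%:Z + 1) m%:Z n%:Z
      + (m%:R + 1) / (m%:R + n%:R - p%:R + 1) * G alpha p%:Z (m%:Z + 1) n%:Z
      - (p%:R + alpha) / (m%:R + n%:R - p%:R + 1) * G alpha (p%:Z - 1) m%:Z n%:Z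
      - 2 * (p%:R - m%:R) * G alpha p%:Z m%:Z n%:Z = 0.
Proof.
move=> halpha pmn; have a0 : 0 < alpha + 1 by lra.
(* [N] has to exceed (m + 1) + n, the largest index sum among the shifted terms. *)
pose a := alpha + 1; pose N := (m + n).+2.
pose q : int := m%:Z + n%:Z - p%:Z.
pose K := Gamma a * pochhammer a m * pochhammer a n.
have qE : m%:R + n%:R - p%:R = q%:~R :> R by rewrite rmorphB rmorphD/= -!pmulrn.
have q1 : q%:~R + 1 != 0 :> R.
  by rewrite -qE gt_eqF// ltr_pwDr// -natrD subr_ge0 ler_nat.
have h0 : G alpha p m n = K * tsum a N q m n.
  by rewrite /G (@G_nat_tsum _ _ _ _ _ N).
(* The factor q stays in [h1] and [h2]: at q = 0 the shifted indices leave the range of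
   [G_nat_tsum], and both sides vanish through q. *)
have h1 : (m%:R + alpha) * q%:~R * G alpha p%:Z (m%:Z - 1) n%:Z
    = q%:~R * (K * tsum a N (q - 1) (m%:Z - 1) n).
  case: m @N @q @K pmn qE {q1 h0} => [|m] N q K pmn qE.
    by rewrite [G _ _ _ _]/= tsum_eq0// !mulr0.
  have -> : m.+1%:Z - 1 = m by lia.
  have [->|q0] := eqVneq q 0; first by rewrite mulr0 !mul0r.
  rewrite /G (@G_nat_tsum _ _ _ _ _ N)//; [|lia|lia].
  have -> : m%:Z + n%:Z - p%:Z = q - 1 by rewrite /q; lia.
  by rewrite /K pochhammerS /a -natr1; ring.
have h2 : q%:~R * G alpha (p%:Z + 1) m%:Z n%:Z
    = q%:~R * (K * tsum a N (q - 1) m n).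
  have [->|q0] := eqVneq q 0; first by rewrite !mul0r.
  have -> : p%:Z + 1 = p.+1 by lia.
  rewrite /G (@G_nat_tsum _ _ _ _ _ N)//; last by lia.
  by have -> : m%:Z + n%:Z - p.+1%:Z = q - 1 by rewrite /q; lia.
have h3 : G alpha p%:Z (m%:Z + 1) n%:Z
    = K * (a + m%:R) * tsum a N (q + 1) (m%:Z + 1) n.
  have -> : m%:Z + 1 = m.+1 by lia.
  rewrite /G (@G_nat_tsum _ _ _ _ _ N)//; [|lia].
  have -> : m.+1%:Z + n%:Z - p%:Z = q + 1 by rewrite /q; lia.
  by rewrite /K pochhammerS -/a; ring.
have h4 : G alpha (p%:Z - 1) m%:Z n%:Z = K * tsum a N (q + 1) m n.
  (* At p = 0 the left side is 0 by convention. The right side agrees, since m + n + 1 > 2 min(m,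
     n). *)
  case: p @q pmn {qE q1 h0 h1 h2 h3} => [|p] q pmn.
    rewrite [G _ _ _ _]/=.
    have [mn|nm] := leqP m n; first by rewrite tsum_eq0 ?mulr0// /q; lia.
    by rewrite tsumC tsum_eq0 ?mulr0// /q; lia.
  have -> : p.+1%:Z - 1 = p by lia.
  rewrite /G (@G_nat_tsum _ _ _ _ _ N)//; [|lia].
  by have -> : m%:Z + n%:Z - p%:Z = q + 1 by rewrite /q; lia.
have pE : p%:R = m%:~R + n%:~R - q%:~R :> R by rewrite -qE -!pmulrn; ring.
have rel := @tsum_contiguous _ a p%:R N q m n a0 pE ltac:(lia).
rewrite -!pmulrn in rel.
rewrite qE h1 -(mulrA (p%:R + 1)) h2 h3 h4 h0.
(* The factor [K / (q + 1)] undoes the normalization of [tsum_contiguous]. *)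
apply: etrans (mulr0 (K / (q%:~R + 1))); rewrite -rel.
have -> : alpha = a - 1 by rewrite addrK.
by field.
Qed.

Theorem theorem7p2 (R : realType) (alpha : R) (p m n : nat)
  (halpha : -1 < alpha)
  (hp_ge : (`|n%:Z - m%:Z| <= p)%N) (hp_le : (p <= m + n)%N) :
  [/\ (m%:R + alpha) * (m%:R + n%:R - p%:R) * G alpha p%:Z (m%:Z - 1) n%:Z
      - (p%:R + 1) * (m%:R + n%:R - p%:R) * G alpha (p%:Z + 1) m%:Z n%:Z
      + (m%:R + 1) / (m%:R + n%:R - p%:R + 1) * G alpha p%:Z (m%:Z + 1) n%:Z
      - (p%:R + alpha) / (m%:R + n%:R - p%:R + 1) * G alpha (p%:Z - 1) m%:Z n%:Z
      - 2 * (p%:R - m%:R) * G alpha p%:Z m%:Z n%:Z = 0,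
      (n%:R + alpha) * (m%:R + n%:R - p%:R) * G alpha p%:Z m%:Z (n%:Z - 1)
      - (p%:R + 1) * (m%:R + n%:R - p%:R) * G alpha (p%:Z + 1) m%:Z n%:Z
      + (n%:R + 1) / (m%:R + n%:R - p%:R + 1) * G alpha p%:Z m%:Z (n%:Z + 1)
      - (p%:R + alpha) / (m%:R + n%:R - p%:R + 1) * G alpha (p%:Z - 1) m%:Z n%:Z
      - 2 * (p%:R - n%:R) * G alpha p%:Z m%:Z n%:Z = 0
    & (n%:R + alpha) * (m%:R + n%:R - p%:R) * G alpha p%:Z m%:Z (n%:Z - 1)
      - (m%:R + alpha) * (m%:R + n%:R - p%:R) * G alpha p%:Z (m%:Z - 1) n%:Z
      - (m%:R + 1) / (m%:R + n%:R - p%:R + 1) * G alpha p%:Z (m%:Z + 1) n%:Z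
      + (n%:R + 1) / (m%:R + n%:R - p%:R + 1) * G alpha p%:Z m%:Z (n%:Z + 1)
      - 2 * (m%:R - n%:R) * G alpha p%:Z m%:Z n%:Z = 0].
Proof.
have rel_m := G_contiguous halpha hp_le.
have rel_n := @G_contiguous R alpha p n m halpha _.
rewrite addnC in rel_n; have {}rel_n := rel_n hp_le.
rewrite [n%:R + m%:R]addrC !(GC _ _ n%:Z) !(GC _ _ (n%:Z - 1))
  !(GC _ _ (n%:Z + 1)) in rel_n.
split=> //; rewrite -[RHS](subrr 0) -{1}rel_n -rel_m; ring.
Qed.
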